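(* Let $(\mathfrak{X},\mathcal{A},\mu)$ and $(\mathfrak{Y},\mathcal{B},\nu)$ be Polish probability spaces, and let $F:\mathfrak{X}\rightarrow\mathfrak{Y}$ be a measurable multifunction whose graph $\{(x,y)\in\mathfrak{X}\times\mathfrak{Y}: y\in F(x)\}$ is closed in the product topology on $\mathfrak{X}\times\mathfrak{Y}$. Then there exists a disintegration of $\mu$ along $F$ with respect to $\nu$ if and only if $\mu(F^{-1}U)\geq\nu(U)$ for all open sets $U\subseteq\mathfrak{Y}$.
   Context: A Polish probability space is a triple $(\mathfrak{X},\mathcal{A},\mu)$ where $\mathfrak{X}$ is a Polish space, $\mathcal{A}$ is its Borel $\sigma$-algebra and $\mu$ is a Borel probability measure. A multifunction $F:\mathfrak{X}\rightarrow\mathfrak{Y}$ assigns to each $x\in\mathfrak{X}$ a (possibly empty) subset $F(x)\subseteq\mathfrak{Y}$. For $B\subseteq\mathfrak{Y}$, $F^{-1}B:=\{x\in\mathfrak{X}: F(x)\cap B\neq\varnothing\}$; in particular $F^{-1}\{y\}=\{x\in\mathfrak{X}: y\in F(x)\}$. $F$ is measurable if $F^{-1}B\in\mathcal{A}$ for all $B\in\mathcal{B}$. A disintegration of $\mu$ along a measurable multifunction $F$ with respect to $\nu$ is a map $y\mapsto\mu_y$ from $\mathfrak{Y}$ to the Borel probability measures on $\mathfrak{X}$ such that: (i) $y\mapsto\mu_y(A)$ is $\mathcal{B}$-measurable for every $A\in\mathcal{A}$; (ii) $\mu_y$ is supported on $F^{-1}\{y\}$, i.e. $\mu_y(F^{-1}\{y\})=1$,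 for $\nu$-almost every $y\in\mathfrak{Y}$; (iii) $\mu=\int \mu_y\,\nu(dy)$, i.e. $\mu(A)=\int\mu_y(A)\,\nu(dy)$ for all $A\in\mathcal{A}$. *)

(* Defs.v *)
From HB Require Import structures.
From mathcomp Require Import all_boot all_order all_algebra.
From mathcomp Require Import all_classical all_reals all_analysis.
From mathcomp Require Import measurable_realfun.

Set Implicit Arguments.
Unset Strict Implicit.
Unset Printing Implicit Defensive.

Local Open Scope classical_set_scope.
Local Open Scope ring_scope.
Local Open Scope measure_display_scope.

Definition separable_space (T : topologicalType) :=
  exists2 D : set T, countable D & dense D.

(* The last clause is the field [cauchy_cvg] of the library's [completeType],
   with the limit quantified so that [M] need not be pointed. *)
Definition completely_metrizable (R : realType) (T : topologicalType) :=
  exists (M : metricType R) (f : T -> M) (g : M -> T),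
    [/\ cancel f g, cancel g f, continuous f, continuous g &
        forall G : set_system M, ProperFilter G -> cauchy G ->
          exists l : M, G --> l].

Definition polish_space (R : realType) (T : topologicalType) :=
  separable_space T /\ completely_metrizable R T.

(* The carrier is still [T], but this type carries no topology: [open] and
   [closed] are to be used at type [T]. *)
Definition borel (T : ptopologicalType) : measurableType (@open T).-sigma :=
  g_sigma_algebraType (@open T).

(* A multifunction from [X] to [Y] is a map [X -> set Y]. *)
Definition mf_preimage (X Y : Type) (F : X -> set Y) (B : set Y) : set X :=
  [set x | F x `&` B !=set0].

Definition mf_graph (X Y : Type) (F : X -> set Y) : set (X * Y) :=
  [set xy | F xy.1 xy.2].

Definition mf_measurable (X Y : ptopologicalType) (F : X -> set Y) :=
  forall B : set Y, measurable (B : set (borel Y)) ->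
    measurable (mf_preimage F B : set (borel X)).

Definition disintegration (R : realType) (X Y : ptopologicalType)
    (mu : probability (borel X) R) (nu : probability (borel Y) R)
    (F : X -> set Y) (mu_ : borel Y -> probability (borel X) R) :=
  [/\ forall A : set (borel X), measurable A ->
        measurable_fun [set: borel Y] (fun y => mu_ y A),
      {ae nu, forall y, mu_ y (mf_preimage F [set y]) = 1%E} &
      forall A : set (borel X), measurable A ->
        mu A = (\int[nu]_y mu_ y A)%E].

(* Main.v *)
Require Import Defs.
From HB Require Import structures.
From mathcomp Require Import all_boot all_order all_algebra.
From mathcomp Require Import all_classical all_reals all_analysis.
From mathcomp Require Import measurable_realfun.

Set Implicit Arguments.
Unset Strict Implicit.
Unset Printing Implicit Defensive.

Import Order.TTheory GRing.Theory Num.Theory.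
Import numFieldNormedType.Exports.

Local Open Scope classical_set_scope.
Local Open Scope ring_scope.

(** The condition is the infinite version of Hall's marriage condition: the mass
    of [U] has to be sent inside [mf_preimage F U]. It is necessary because,
    for almost every [y] in [U], the measure [mu_ y] lives on the fiber of [y],
    which is part of [mf_preimage F U].

    For sufficiency, the complement of the graph is open, hence a countable
    union of open rectangles [U k `*` V k] (graph_cover), and a coupling of [mu]
    and [nu] that gives mass zero to each of them is a coupling carried by the
    graph. To avoid the first [n] rectangles only the finitely many atoms of the
    algebras generated by the [U k] and by the [V k] matter, and the question is
    a finite transport problem, solved by Hall's condition (hall_transport). For
    a set [S] of atoms of [Y], this condition can be checked on the upward
    closure of [S], since adding to an atom of [Y] more of the sets [V k] only
    forbids more atoms of [X]. The union of an upward closed set of atoms is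
    open, so that the hypothesis on open sets is exactly what is needed
    (finite_coupling, open_incidence_upset).

    The couplings so obtained are combined along an ultrafilter
    (bicontent_limit). The limit [l A B] is only a finitely additive function of
    rectangles, but [l A B <= mu A] and [l A B <= nu B], so that it is countably
    additive in each variable separately, and this is all that is required to
    disintegrate. By Radon-Nikodym, each [l A] has a density with respect to
    [nu]. A sequence of sets of [X] splits [X] into a binary tree of cells, and
    the densities of the cells give, for each [y], conditional probabilities of
    going left or right in the tree, that is a law on [nat -> bool], realized by
    cutting the unit interval with Lebesgue measure (locate, bits_kernel). As
    [X] is separable and complete, it is a measurable retract of [nat -> bool]:
    a point is recorded by the basic balls that contain it, and is recovered
    from them measurably (decode). Pushing the laws forward by the retraction
    gives the kernel (polish_kernel). *)

(** * Transport on finite sets under a Hall condition *)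

Section transport.
Context {R : realFieldType} {I J : finType} (E : I -> J -> bool).
Implicit Types (p : I -> R) (q : J -> R) (S : {set J}).

Definition neighbors S : {set I} := [set i | [exists j in S, E i j]]%SET.

Definition hall_condition p q :=
  forall S, \sum_(j in S) q j <= \sum_(i in neighbors S) p i.

Definition transportable p q := exists c : I -> J -> R,
  [/\ forall i j, 0 <= c i j, forall i j, ~~ E i j -> c i j = 0,
      forall j, \sum_i c i j = q j & forall i, \sum_j c i j <= p i].

(** The measure that decreases in the induction of hall_transport. *)
Definition nsupp (K : finType) (f : K -> R) := #|[set k | f k != 0]%SET|.

Lemma transportableD p q p1 q1 p2 q2 :
    (forall i, p1 i + p2 i = p i) -> (forall j, q1 j + q2 j = q j) ->
  transportable p1 q1 -> transportable p2 q2 -> transportable p q.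
Proof.
move=> pE qE [c1 [c10 E1 q1E p1E]] [c2 [c20 E2 q2E p2E]].
exists (fun i j => c1 i j + c2 i j); split => [i j|i j nE|j|i].
- by rewrite addr_ge0.
- by rewrite E1 ?E2 ?addr0.
- by rewrite big_split/= q1E q2E.
- by rewrite big_split/= -pE lerD.
Qed.

Lemma transportable_edge i0 j0 t : 0 <= t -> E i0 j0 ->
  transportable (fun i => t *+ (i == i0)) (fun j => t *+ (j == j0)).
Proof.
move=> t0 Eij; exists (fun i j => t *+ (i == i0) *+ (j == j0)); split.
- by move=> i j; rewrite !mulrn_wge0.
- move=> i j nE; case: eqP => [ii|]; last by rewrite mulr0n mul0rn.
  by case: eqP => [jj|]; [rewrite ii jj Eij in nE|rewrite mulr0n].
- move=> j; rewrite (bigD1 i0)//= eqxx big1 ?addr0// => i /negbTE ->.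
  by rewrite mulr0n mul0rn.
- move=> i; rewrite (bigD1 j0)//= eqxx big1 ?addr0// => j /negbTE ->.
  by rewrite mulr0n.
Qed.

Lemma ltn_nsupp (K : finType) (f g : K -> R) k :
  (forall x, f x = 0 -> g x = 0) -> f k != 0 -> g k = 0 ->
  (nsupp g < nsupp f)%N.
Proof.
move=> fg fk gk; apply: proper_card; apply/properP; split.
  by apply/fintype.subsetP => x; rewrite !inE; apply: contraNN => /eqP/fg ->.
by exists k; rewrite !inE// gk eqxx.
Qed.

Lemma leq_nsupp (K : finType) (f g : K -> R) :
  (forall x, f x = 0 -> g x = 0) -> (nsupp g <= nsupp f)%N.
Proof.
move=> fg; apply: subset_leq_card.
by apply/fintype.subsetP => x; rewrite !inE; apply: contraNN => /eqP/fg ->.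
Qed.

Lemma sumr_subset (K : finType) (f : K -> R) (A B : {set K}) :
  (forall k, 0 <= f k) -> A \subset B -> \sum_(k in A) f k <= \sum_(k in B) f k.
Proof.
move=> f0 AB; rewrite [leRHS](big_setID A)/= (finset.setIidPr AB) lerDl.
by rewrite sumr_ge0.
Qed.

Lemma sumr_point (K : finType) (t : R) (k : K) (A : {set K}) :
  \sum_(x in A) t *+ (x == k) = t *+ (k \in A).
Proof.
rewrite big_mkcond/= (bigD1 k)//= big1 ?addr0; last first.
  by move=> x /negbTE ->; rewrite mulr0n if_same.
by rewrite eqxx; case: (k \in A).
Qed.

Lemma sumr_setI (K : finType) (f : K -> R) (A B : {set K}) :
  \sum_(k in A) f k *+ (k \in B) = \sum_(k in A :&: B) f k.
Proof.
rewrite [RHS](eq_bigl (fun k => (k \in A) && (k \in B))).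
  by rewrite [RHS]big_mkcondr/=; apply: eq_bigr => k _; case: (k \in B).
by move=> k; rewrite inE.
Qed.

Lemma sumr_setD (K : finType) (f : K -> R) (A B : {set K}) :
  \sum_(k in A) f k *+ (k \notin B) = \sum_(k in A :\: B) f k.
Proof.
rewrite finset.setDE -sumr_setI; by apply: eq_bigr => k _; rewrite inE.
Qed.

(** Ship as much as possible along one admissible edge [(i, j)] while keeping
    the Hall condition. Either [i] or [j] is then exhausted, or some set [S] of
    demands with [j] outside [S] and [i] among its neighbors has become tight.
    In the latter case the problem splits into two independent ones, [S] with
    its neighbors and the complements, and both are smaller since the first has
    lost [j] and the second has lost [i]. *)
Lemma hall_transport p q : (forall i, 0 <= p i) -> (forall j, 0 <= q j) ->
  hall_condition p q -> transportable p q.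
Proof.
have [n] := ubnP (nsupp p + nsupp q).
elim: n => // n IH in p q * => pqn p0 q0 hpq.
have [/existsP[j qj]|/existsPn qz] := boolP [exists j, q j != 0]; last first.
  exists (fun _ _ => 0); split => // [j|i]; rewrite big1 ?p0//.
  by apply/esym/eqP; apply: contraNT (qz j).
have {}qj : 0 < q j by rewrite lt_neqAle eq_sym qj q0.
have [i /andP[Eij pi]] : exists i, E i j && (0 < p i).
  apply/existsP; apply: contraT => /existsPn np.
  have := hpq [set j]%SET; rewrite big_set1 leNgt => /negP[].
  rewrite big1// => i; rewrite inE => /existsP[j' /andP[]].
  rewrite inE => /eqP -> Eij.
  have := np i; rewrite Eij/= lt_neqAle p0 andbT negbK => /eqP <-//.
pose slack S := \sum_(i in neighbors S) p i - \sum_(j in S) q j.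
pose T S := (i \in neighbors S) && (j \notin S).
(* Shipping [t] along the edge only affects the slack of the sets in [T]: if [S]
   contains [j] then [i] is a neighbor, and both sides lose [t]. *)
have push t : 0 <= t -> t <= p i -> t <= q j -> (forall S, T S -> t <= slack S) ->
  let p' := fun i' => p i' - t *+ (i' == i) in
  let q' := fun j' => q j' - t *+ (j' == j) in
  [/\ forall i, 0 <= p' i, forall j, 0 <= q' j, hall_condition p' q' &
      transportable p' q' -> transportable p q].
  move=> t0 tp tq tS p' q'; split.
  - move=> i'; rewrite /p'; case: eqP => [->|_].
      by rewrite mulr1n subr_ge0.
    by rewrite mulr0n subr0.
  - move=> i'; rewrite /q'; case: eqP => [->|_].
      by rewrite mulr1n subr_ge0.
    by rewrite mulr0n subr0.
  - move=> S; rewrite -subr_ge0 /p' /q' !sumrB.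
    rewrite !sumr_point; have := hpq S; rewrite -subr_ge0 => hS.
    have [jS|jS] := boolP (j \in S).
      have -> : i \in neighbors S by rewrite inE; apply/existsP; exists j; rewrite jS.
      by rewrite opprB addrA addrNK.
    rewrite subr0; have [iS|iS] := boolP (i \in neighbors S); last by rewrite subr0.
    by rewrite addrAC subr_ge0; apply: tS; rewrite /T iS.
  - move=> h; apply: transportableD h (transportable_edge t0 Eij) => k.
      by rewrite subrK.
    by rewrite subrK.
have [/existsP[S0 /andP[TS0 S0m]]|/existsPn Tm] :=
  boolP [exists S, T S && (slack S < Num.min (p i) (q j))]; last first.
  have [||||p0' q0' hpq'] := push (Num.min (p i) (q j)).
  - by rewrite le_min p0 q0.
  - by rewrite ge_min lexx.
  - by rewrite ge_min lexx orbT.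
  - by move=> S TS; have := Tm S; rewrite TS/= -leNgt.
  apply; apply: IH => //.
  rewrite -ltnS; apply: leq_trans pqn; rewrite ltnS.
  have hp : (forall x, p x = 0 -> p x - Num.min (p i) (q j) *+ (x == i) = 0).
    move=> x; case: eqP => [-> pi0|_ ->]; last by rewrite mulr0n subr0.
    by rewrite pi0 ltxx in pi.
  have hq : (forall x, q x = 0 -> q x - Num.min (p i) (q j) *+ (x == j) = 0).
    move=> x; case: eqP => [-> qj0|_ ->]; last by rewrite mulr0n subr0.
    by rewrite qj0 ltxx in qj.
  have [pq|qp] := leP (p i) (q j).
    rewrite -addSn leq_add//; last by apply: leq_nsupp => x /hq; rewrite min_l.
    apply: (@ltn_nsupp _ _ _ i); last by rewrite eqxx mulr1n subrr.
      by move=> x /hp; rewrite min_l.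
    by rewrite gt_eqF.
  rewrite -addnS leq_add//.
    by apply: leq_nsupp => x /hp; rewrite min_r// ltW.
  apply: (@ltn_nsupp _ _ _ j); last by rewrite eqxx mulr1n subrr.
    by move=> x /hq; rewrite min_r// ltW.
  by rewrite gt_eqF.
pose S := [arg min_(S < S0 | T S) slack S]%O.
have [TS Smin] : T S /\ forall S', T S' -> slack S <= slack S'.
  by rewrite /S; case: arg_minP.
have : slack S < Num.min (p i) (q j) by exact: le_lt_trans (Smin _ TS0) S0m.
rewrite lt_min => /andP[Sp Sq].
have [|||p0' q0' hpq'] := push (slack S) _ _ _ Smin.
- by rewrite subr_ge0; exact: hpq.
- exact: ltW.
- exact: ltW.
set p' := fun i => _; set q' := fun j => _.
apply.
have [iS jS] := andP TS.
have tight : \sum_(j in S) q' j = \sum_(i in neighbors S) p' i.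
  by rewrite !sumrB !sumr_point iS (negbTE jS) subr0 /slack subKr.
have p'z x : p x = 0 -> p' x = 0.
  rewrite /p'; case: eqP => [-> pi0|_ ->]; last by rewrite mulr0n subr0.
  by rewrite pi0 ltxx in pi.
have q'z x : q x = 0 -> q' x = 0.
  rewrite /q'; case: eqP => [-> qj0|_ ->]; last by rewrite mulr0n subr0.
  by rewrite qj0 ltxx in qj.
apply: (@transportableD _ _
  (fun i => p' i *+ (i \in neighbors S)) (fun j => q' j *+ (j \in S))
  (fun i => p' i *+ (i \notin neighbors S)) (fun j => q' j *+ (j \notin S))).
- by move=> k; case: (k \in _); rewrite ?addr0 ?add0r.
- by move=> k; case: (k \in _); rewrite ?addr0 ?add0r.
- apply: IH.
  + rewrite -ltnS; apply: leq_trans pqn; rewrite ltnS -addnS leq_add//.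
      by apply: leq_nsupp => x /p'z ->; rewrite mul0rn.
    apply: (@ltn_nsupp _ _ _ j); last by rewrite (negbTE jS).
      by move=> x /q'z ->; rewrite mul0rn.
    by rewrite gt_eqF.
  + by move=> k; apply/mulrn_wge0/p0'.
  + by move=> k; apply/mulrn_wge0/q0'.
  + move=> S'; rewrite !sumr_setI finset.setIC.
    apply: le_trans (hpq' (S :&: S')%SET) _; apply: sumr_subset => //.
    apply/fintype.subsetP => k; rewrite inE => /existsP[l /andP[]].
    rewrite inE => /andP[lS lS'] kl.
    by rewrite !inE; apply/andP; split; apply/existsP; exists l; rewrite ?lS ?lS'.
- apply: IH.
  + rewrite -ltnS; apply: leq_trans pqn; rewrite ltnS -addSn leq_add//; last first.
      by apply: leq_nsupp => x /q'z ->; rewrite mul0rn.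
    apply: (@ltn_nsupp _ _ _ i); last by rewrite iS.
      by move=> x /p'z ->; rewrite mul0rn.
    by rewrite gt_eqF.
  + by move=> k; apply/mulrn_wge0/p0'.
  + by move=> k; apply/mulrn_wge0/q0'.
  + move=> S'; rewrite !sumr_setD -(lerD2l (\sum_(j in S) q' j)) {2}tight.
    have := hpq' (S :|: S')%SET.
    rewrite (big_setID S)/= finset.setUK finset.setDUl finset.setDv finset.set0U.
    move=> /le_trans; apply.
    rewrite (big_setID (neighbors S))/= lerD//; apply: sumr_subset => //.
      exact: finset.subsetIr.
    apply/fintype.subsetP => k; rewrite !inE => /andP[kS /existsP[l /andP[]]].
    rewrite inE => lSS kl; rewrite kS/=; apply/existsP; exists l; rewrite kl andbT.
    case/orP: lSS => // lS; case/negP: kS; apply/existsP; exists l; exact/andP.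
Qed.
End transport.

(** * Couplings of finite partitions *)

Section fiber_partition.
Context d (T : measurableType d) (R : realType) (m : {finite_measure set T -> \bar R}).
Context (K : finType) (g : T -> K).
Hypothesis mg : forall k, measurable (g @^-1` [set k]).

Lemma measurable_fiber (S : {set K}) : measurable (g @^-1` [set` S]).
Proof.
have -> : g @^-1` [set` S] = \bigcup_(k in [set` S]) g @^-1` [set k].
  apply/seteqP; split => [x Sx|x [k Sk] /= ->//]; by exists (g x).
by apply: fin_bigcup_measurable => //; exact: finite_finset.
Qed.

Lemma fine_measureU (A B : set T) : measurable A -> measurable B -> A `&` B = set0 ->
  fine (m (A `|` B)) = fine (m A) + fine (m B).
Proof. by move=> mA mB AB; rewrite measureU// fineD// fin_num_measure. Qed.

Lemma fine_measure_fiber (A : set T) (S : {set K}) : measurable A ->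
  fine (m (A `&` g @^-1` [set` S])) = \sum_(k in S) fine (m (A `&` g @^-1` [set k])).
Proof.
move=> mA; have [n] := ubnP #|S|; elim: n => // n IH in S *; rewrite ltnS => Sn.
have [->|[k kS]] := set_0Vmem S.
  rewrite big_set0 [X in m X](_ : _ = set0) ?measure0//.
  by rewrite -subset0 => x [_]/=; rewrite inE.
rewrite (big_setD1 k kS)/= -IH; last first.
  by move: Sn; rewrite (cardsD1 k) kS.
rewrite -fine_measureU//.
- congr (fine (m _)); rewrite -setIUr; congr (_ `&` _).
  apply/seteqP; split => [x/= xS|x/= [->//|]]; last by rewrite inE => /andP[].
  by have [->|gk] := eqVneq (g x) k; [left|right; rewrite !inE gk].
- exact: measurableI.
- by apply: measurableI => //; exact: measurable_fiber.
- by rewrite -subset0 => x [[_/= ->] [_]]/=; rewrite !inE eqxx.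
Qed.

Lemma fine_measure_fiberT (A : set T) : measurable A ->
  fine (m A) = \sum_k fine (m (A `&` g @^-1` [set k])).
Proof.
move=> mA; rewrite -[in LHS](setIT A).
rewrite [X in _ `&` X](_ : _ = g @^-1` [set` [set: K]%SET]).
  by rewrite fine_measure_fiber//; apply: eq_bigl => k; rewrite inE.
by apply/seteqP; split => x//= _; rewrite inE.
Qed.

End fiber_partition.

Section incidence.
Context (T : Type) (U : nat -> set T) (n : nat).
Definition incidence x : {ffun 'I_n -> bool} := [ffun i : 'I_n => `[< U i x >]].
Lemma incidenceP x (i : 'I_n) : reflect (U i x) (incidence x i).
Proof. by rewrite ffunE; exact: asboolP. Qed.
End incidence.

Lemma measurable_incidence d (T : measurableType d) (U : nat -> set T) n :
  (forall i, measurable (U i)) -> forall s, measurable (incidence U n @^-1` [set s]).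
Proof.
move=> mU s.
have -> : incidence U n @^-1` [set s] =
    \bigcap_(i in [set: 'I_n]) (if s i then U i else ~` U i).
  apply/seteqP; split => [x/= <- i _|x xs].
    by case: incidenceP.
  apply/ffunP => i; have := xs i I.
  by case: incidenceP; case: (s i).
apply: fin_bigcap_measurable => // i _.
by case: (s i) => //; exact: measurableC.
Qed.

Section bimeasure.
Context {R : realType} {d1 d2} {T1 : measurableType d1} {T2 : measurableType d2}.
Context (mu : probability T1 R) (nu : probability T2 R).

(** A finitely additive coupling, known on rectangles only. Positivity and
    additivity are asked of measurable sets because the limits below are
    meaningless on others. *)
Record bicontent (l : set T1 -> set T2 -> R) : Prop := Bicontent {
  bicontent_ge0 : forall A B, measurable A -> measurable B -> 0 <= l A B ;
  bicontentUl : forall A A' B, measurable A -> measurable A' -> measurable B ->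
    A `&` A' = set0 -> l (A `|` A') B = l A B + l A' B ;
  bicontentUr : forall A B B', measurable A -> measurable B -> measurable B' ->
    B `&` B' = set0 -> l A (B `|` B') = l A B + l A B' ;
  bicontentTr : forall A, measurable A -> l A setT = fine (mu A) ;
  bicontentTl : forall B, measurable B -> l setT B = fine (nu B) }.

(** The atoms of the [U k] and of the [V k], [k < n], are indexed by the subsets
    of ['I_n], and two atoms are compatible when their indices are disjoint. A
    transport between the masses of the atoms is turned into a coupling by
    spreading it inside each product of atoms as a product measure. It is enough
    to assume the Hall condition for upward closed families, because a set of
    indices has the same neighbors as its upward closure. *)
Lemma finite_coupling n (U : nat -> set T1) (V : nat -> set T2) :
    (forall k, measurable (U k)) -> (forall k, measurable (V k)) ->
    (forall S : {set {ffun 'I_n -> bool}},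
      (forall t t' : {ffun 'I_n -> bool},
        t \in S -> (forall i, t i -> t' i) -> t' \in S) ->
      (nu (incidence V n @^-1` [set` S]) <=
       mu [set x | exists2 t, t \in S & forall i, ~~ (incidence U n x i && t i)])%E) ->
  exists2 l, bicontent l & forall k, (k < n)%N -> l (U k) (V k) = 0.
Proof.
move=> mU mV hS.
pose gU := incidence U n; pose gV := incidence V n.
have mgU : forall s, measurable (gU @^-1` [set s]) by exact: measurable_incidence.
have mgV : forall s, measurable (gV @^-1` [set s]) by exact: measurable_incidence.
pose E (s t : {ffun 'I_n -> bool}) := [forall i, ~~ (s i && t i)].
pose p s := fine (mu (gU @^-1` [set s])).
pose q s := fine (nu (gV @^-1` [set s])).
have p0 s : 0 <= p s by rewrite fine_ge0.
have q0 s : 0 <= q s by rewrite fine_ge0.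
have hpq : hall_condition E p q.
  move=> S; pose S' := [set t' : {ffun 'I_n -> bool} |
    [exists t in S, [forall i, t i ==> t' i]]]%SET.
  have SS' : S \subset S'.
    apply/fintype.subsetP => t tS; rewrite inE; apply/existsP; exists t; rewrite tS/=.
    by apply/forallP => i; rewrite implybb.
  apply: le_trans (sumr_subset q0 SS') _.
  have := hS S' _.
  have -> : [set x | exists2 t, t \in S' & forall i, ~~ (incidence U n x i && t i)] =
     gU @^-1` [set` neighbors E S].
    apply/seteqP; split => x /=; rewrite inE.
      move=> [t]; rewrite inE => /existsP[t0 /andP[t0S /forallP tt0]] h.
      apply/existsP; exists t0; rewrite t0S/=; apply/forallP => i.
      apply: contraNN (h i) => /andP[-> /=]; exact: (implyP (tt0 i)).
    move=> /existsP[t /andP[tS /forallP h]]; exists t => //.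
    exact: (fintype.subsetP SS').
  rewrite -[X in (X <= _)%E]fineK ?fin_num_measure//; last exact: measurable_fiber.
  rewrite -[X in (_ <= X)%E]fineK ?fin_num_measure//; last exact: measurable_fiber.
  rewrite lee_fin -[X in nu X]setTI -[X in mu X]setTI !fine_measure_fiber//.
  under eq_bigr do rewrite setTI; under [in X in _ <= X]eq_bigr do rewrite setTI.
  apply; move=> t t'; rewrite !inE => /existsP[t0 /andP[t0S /forallP tt0]] h.
  apply/existsP; exists t0; rewrite t0S/=; apply/forallP => i.
  by apply/implyP => t0i; apply: h; exact: (implyP (tt0 i)).
have [c [c0 cE cq cp']] := hall_transport p0 q0 hpq.
(* No supply is left over since both total masses are 1. *)
have cp s : \sum_t c s t = p s.
  apply/eqP; move: s.
  have : \sum_s (p s - \sum_t c s t) == 0.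
    rewrite sumrB exchange_big/= (eq_bigr _ (fun t _ => cq t)).
    have -> : \sum_t p t = 1.
      transitivity (fine (mu setT)); last by rewrite probability_setT.
      by rewrite (fine_measure_fiberT mu mgU)//; apply: eq_bigr => k _; rewrite setTI.
    have -> : \sum_t q t = 1.
      transitivity (fine (nu setT)); last by rewrite probability_setT.
      by rewrite (fine_measure_fiberT nu mgV)//; apply: eq_bigr => k _; rewrite setTI.
    by rewrite subrr.
  rewrite psumr_eq0; last by move=> s _; rewrite subr_ge0.
  move=> /allP h s; have := h s; rewrite mem_index_enum => /(_ isT)/=.
  by rewrite subr_eq0 eq_sym.
have cp0 s t : p s = 0 -> c s t = 0.
  move=> ps; have /eqP := cp s; rewrite ps psumr_eq0; last by move=> *; exact: c0.
  by move=> /allP/(_ t); rewrite mem_index_enum => /(_ isT)/eqP.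
have cq0 s t : q t = 0 -> c s t = 0.
  move=> qt; have /eqP := cq t; rewrite qt psumr_eq0; last by move=> *; exact: c0.
  by move=> /allP/(_ s); rewrite mem_index_enum => /(_ isT)/eqP.
pose P A s := fine (mu (A `&` gU @^-1` [set s])) / p s.
pose Q B t := fine (nu (B `&` gV @^-1` [set t])) / q t.
have P0 A s : 0 <= P A s by rewrite divr_ge0// fine_ge0.
have Q0 B t : 0 <= Q B t by rewrite divr_ge0// fine_ge0.
have cP s t : c s t * P setT s = c s t.
  rewrite /P setTI -/(p s); have [/cp0 ->|ps] := eqVneq (p s) 0; first by rewrite mul0r.
  by rewrite divff// mulr1.
have cQ s t : c s t * Q setT t = c s t.
  rewrite /Q setTI -/(q t); have [/cq0 ->|qt] := eqVneq (q t) 0; first by rewrite mul0r.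
  by rewrite divff// mulr1.
pose l A B := \sum_s \sum_t c s t * P A s * Q B t.
exists l; last first.
  move=> k kn; rewrite /l big1// => s _; rewrite big1// => t _.
  pose i : 'I_n := Ordinal kn.
  have PE : ~~ s i -> P (U k) s = 0.
    move=> si; rewrite /P [X in mu X](_ : _ = set0) ?measure0 ?mul0r//.
    by rewrite -subset0 => x [/= Ux xs]; move: si; rewrite -xs => /incidenceP.
  have QE : ~~ t i -> Q (V k) t = 0.
    move=> ti; rewrite /Q [X in nu X](_ : _ = set0) ?measure0 ?mul0r//.
    by rewrite -subset0 => x [/= Vx xt]; move: ti; rewrite -xt => /incidenceP.
  have [si|/PE ->] := boolP (s i); last by rewrite mulr0 mul0r.
  have [ti|/QE ->] := boolP (t i); last by rewrite mulr0.
  rewrite cE ?mul0r//; apply/forallPn; exists i.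
  by rewrite negbK si ti.
split.
- move=> A B _ _; apply: sumr_ge0 => s _; apply: sumr_ge0 => t _.
  by apply: mulr_ge0 => //; apply: mulr_ge0.
- move=> A A' B mA mA' mB AA'; rewrite /l -big_split/=; apply: eq_bigr => s _.
  rewrite -big_split/=; apply: eq_bigr => t _; rewrite -mulrDl -mulrDr; congr (_ * _ * _).
  rewrite /P setIUl fine_measureU ?mulrDl//; [exact: measurableI..|].
  by rewrite setIACA AA' set0I.
- move=> A B B' mA mB mB' BB'; rewrite /l -big_split/=; apply: eq_bigr => s _.
  rewrite -big_split/=; apply: eq_bigr => t _; rewrite -mulrDr; congr (_ * _).
  rewrite /Q setIUl fine_measureU ?mulrDl//; [exact: measurableI..|].
  by rewrite setIACA BB' set0I.
- move=> A mA; rewrite (fine_measure_fiberT mu mgU)//; apply: eq_bigr => s _.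
  under eq_bigr do rewrite mulrAC cQ; rewrite -mulr_suml cp /P.
  have [ps|ps] := eqVneq (p s) 0; last by rewrite mulrC divfK.
  rewrite ps mul0r; apply/esym/eqP; rewrite eq_le fine_ge0// andbT -[leRHS]ps.
  apply: fine_le; [exact/fin_num_measure/measurableI|exact/fin_num_measure|].
  by apply: le_measure; rewrite ?inE//; exact: measurableI.
- move=> B mB; rewrite (fine_measure_fiberT nu mgV)// /l exchange_big/=.
  apply: eq_bigr => t _.
  under eq_bigr do rewrite cP; rewrite -mulr_suml cq /Q.
  have [ps|ps] := eqVneq (q t) 0; last by rewrite mulrC divfK.
  rewrite ps mul0r; apply/esym/eqP; rewrite eq_le fine_ge0// andbT -[leRHS]ps.
  apply: fine_le; [exact/fin_num_measure/measurableI|exact/fin_num_measure|].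
  by apply: le_measure; rewrite ?inE//; exact: measurableI.
Qed.

End bimeasure.

(** * Limits of finitely additive couplings *)

Lemma ultra_cvg_segment (R : realType) (T : Type) (G : set_system T)
    (u : T -> R) (a b : R) :
  UltraFilter G -> (forall t, a <= u t <= b) -> exists l : R, u t @[t --> G] --> l.
Proof.
move=> GU uab; have GP : ProperFilter G by exact: ultra_proper.
have := @segment_compact R a b (u @ G) _ _.
case; first by apply: (@filterE _ G) => t /=; rewrite in_itv/=; exact: uab.
move=> l [_ cl]; exists l => B Bl; change (G (u @^-1` B)).
have [//|GnB] := in_ultra_setVsetC (u @^-1` B) GU.
by have [x [nBx Bx]] := cl (~` B) B GnB Bl.
Qed.

Section dominated.
Context d (T : measurableType d) (R : realType) (m : {finite_measure set T -> \bar R}).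

(** Domination by a finite measure turns finite into countable additivity: the
    missing mass of a partial union is at most that of [m], which vanishes. *)
Lemma dominated_additive_measure (k : set T -> R) :
  (forall A, measurable A -> 0 <= k A) ->
  (forall A B, measurable A -> measurable B -> A `&` B = set0 ->
     k (A `|` B) = k A + k B) ->
  (forall A, measurable A -> ((k A)%:E <= m A)%E) ->
  exists M : {finite_measure set T -> \bar R}, forall A, measurable A -> M A = (k A)%:E.
Proof.
move=> k0 kU km.
(* A measure is nonnegative on all sets, and [k] only on measurable ones. *)
pose M A := (if `[< measurable A >] then k A else 0)%:E : \bar R.
have ME A : measurable A -> M A = (k A)%:E by rewrite /M => /asboolP ->.
have kset0 : k set0 = 0.
  by apply: (addrI (k set0)); rewrite -kU ?setI0// setU0 addr0.
have M0 : M set0 = 0%E by rewrite ME// kset0.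
have Mge0 A : (0 <= M A)%E by rewrite /M; case: asboolP => // /k0; rewrite lee_fin.
have ksum (F : nat -> set T) n : (forall i, measurable (F i)) -> trivIset setT F ->
    k (\big[setU/set0]_(i < n) F i) = \sum_(0 <= i < n) k (F i).
  move=> mF tF; elim: n => [|n IH]; first by rewrite big_ord0 big_nil.
  rewrite big_ord_recr/= kU ?IH ?big_nat_recr//; first exact: bigsetU_measurable.
  rewrite -subset0 => x [+ Fn]; rewrite -bigcup_mkord => -[i /= + Fi].
  have -> : i = n by apply: tF => //; exists x.
  by rewrite ltnn.
have Msa : semi_sigma_additive M.
  move=> F mF tF mUF; rewrite ME//.
  rewrite [X in X @ _ --> _](_ : _ =
    EFin \o (fun n => \sum_(0 <= i < n) k (F i))); last first.
    by apply/funext => n /=; rewrite -sumEFin; apply: eq_bigr => i _; rewrite ME.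
  apply: cvg_EFin; first by near=> n.
  pose G n := \big[setU/set0]_(i < n) F i.
  have mG n : measurable (G n) by exact: bigsetU_measurable.
  have GF n : G n `<=` \bigcup_i F i.
    by move=> x; rewrite /G -bigcup_mkord => -[i _ Fx]; exists i.
  have mtail : (fun n => fine (m (G n))) @ \oo --> fine (m (\bigcup_i F i)).
    apply: fine_cvg; rewrite fineK ?fin_num_measure//.
    have -> : \bigcup_i F i = \bigcup_n G n.
      apply/seteqP; split => [x [i _ Fx]|x [i _ Gx]]; last exact: GF Gx.
      by exists i.+1 => //; rewrite /G big_ord_recr/=; right.
    apply: nondecreasing_cvg_mu => //; first exact: bigcupT_measurable.
    by move=> i j ij; apply/subsetPset; exact: subset_bigsetU.
  apply: (@squeeze_cvgr _ _ _ _
      (fun n => k (\bigcup_i F i) - (fine (m (\bigcup_i F i)) - fine (m (G n))))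
      (fun=> k (\bigcup_i F i))).
  - near=> n; rewrite /= -(ksum F n)// -/(G n).
    have kD : k (\bigcup_i F i) = k (G n) + k (\bigcup_i F i `\` G n).
      by rewrite -kU//; [rewrite setDUK|exact: measurableD|rewrite setDIK].
    have mD : fine (m (\bigcup_i F i)) - fine (m (G n)) =
        fine (m (\bigcup_i F i `\` G n)).
      rewrite -[in LHS](setDUK (GF n)) measureU//;
        [|exact: measurableD|by rewrite setDIK].
      by rewrite fineD ?fin_num_measure//; [rewrite addrC addKr|exact: measurableD].
    apply/andP; split.
      rewrite mD kD lerBlDr lerD2l -lee_fin fineK ?fin_num_measure//.
        by apply: km; exact: measurableD.
      exact: measurableD.
    by rewrite kD lerDl k0//; exact: measurableD.
  - rewrite -[X in _ --> X]subr0; apply: cvgB; first exact: cvg_cst.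
    rewrite -[X in _ --> X](subrr (fine (m (\bigcup_i F i)))).
    by apply: cvgB => //; exact: cvg_cst.
  - exact: cvg_cst.
pose M1 : {measure set T -> \bar R} := HB.pack M (isMeasure.Build _ _ _ M M0 Mge0 Msa).
have Mfin : fin_num_fun M by move=> A mA; rewrite ME.
pose M2 : {finite_measure set T -> \bar R} :=
  HB.pack M (Measure.on M1) (Measure_isFinite.Build _ _ _ M1 Mfin).
by exists M2.
Unshelve. all: by end_near. Qed.

End dominated.


Section bicontent.
Context {R : realType} {d1 d2} {T1 : measurableType d1} {T2 : measurableType d2}.
Context (mu : probability T1 R) (nu : probability T2 R).
Implicit Type l : set T1 -> set T2 -> R.

Lemma bicontent_lel l A B : bicontent mu nu l -> measurable A -> measurable B ->
  l A B <= fine (mu A).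
Proof.
move=> L mA mB; rewrite -(bicontentTr L)// -(setUv B) (bicontentUr L) ?setICr//.
  by rewrite lerDl (bicontent_ge0 L)//; exact: measurableC.
exact: measurableC.
Qed.

Lemma bicontent_ler l A B : bicontent mu nu l -> measurable A -> measurable B ->
  l A B <= fine (nu B).
Proof.
move=> L mA mB; rewrite -(bicontentTl L)// -(setUv A) (bicontentUl L) ?setICr//.
  by rewrite lerDl (bicontent_ge0 L)//; exact: measurableC.
exact: measurableC.
Qed.

Lemma bicontent_measurel l B : bicontent mu nu l -> measurable B ->
  exists M : {finite_measure set T1 -> \bar R},
    forall A, measurable A -> M A = (l A B)%:E.
Proof.
move=> L mB; apply: (dominated_additive_measure (m := mu)).
- by move=> A mA; exact: (bicontent_ge0 L).
- by move=> A A' mA mA' AA'; exact: (bicontentUl L).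
- move=> A mA; rewrite -[leRHS]fineK ?fin_num_measure// lee_fin.
  exact: bicontent_lel.
Qed.

Lemma bicontent_measurer l A : bicontent mu nu l -> measurable A ->
  exists M : {finite_measure set T2 -> \bar R},
    forall B, measurable B -> M B = (l A B)%:E.
Proof.
move=> L mA; apply: (dominated_additive_measure (m := nu)).
- by move=> B mB; exact: (bicontent_ge0 L).
- by move=> B B' mB mB' BB'; exact: (bicontentUr L).
- move=> B mB; rewrite -[leRHS]fineK ?fin_num_measure// lee_fin.
  exact: bicontent_ler.
Qed.

(** The limit along an ultrafilter exists on all pairs of measurable sets at
    once, and preserves every linear relation. *)
Lemma bicontent_limit (L : nat -> set T1 -> set T2 -> R) :
    (forall n, bicontent mu nu (L n)) ->
  exists2 l, bicontent mu nu l & forall A B, measurable A -> measurable B ->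
    (\forall n \near \oo, L n A B = 0) -> l A B = 0.
Proof.
move=> bL.
have [G [GU GF]] : exists G : set_system nat, UltraFilter G /\ \oo `<=` G.
  exact: ultraFilterLemma.
have GP : ProperFilter G by exact: ultra_proper.
pose l A B := lim (L n A B @[n --> G]).
have Ll A B : measurable A -> measurable B -> L n A B @[n --> G] --> l A B.
  move=> mA mB; have [|r Lr] := @ultra_cvg_segment R _ _ (fun n => L n A B) 0 1 GU.
    move=> n; rewrite (bicontent_ge0 (bL n))//=.
    rewrite (le_trans (bicontent_lel (bL n) _ _))// -lee_fin fineK ?fin_num_measure//.
    exact: probability_le1.
  by rewrite /l (cvg_lim _ Lr).
have ll A B r : measurable A -> measurable B -> L n A B @[n --> G] --> r -> l A B = r.
  by move=> mA mB Lr; exact: (cvg_unique _ (Ll _ _ mA mB) Lr).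
exists l; last first.
  move=> A B mA mB LAB0; apply: ll => //.
  by apply: cvg_near_cst; exact: (GF _ LAB0).
split.
- move=> A B mA mB; apply: (@limr_ge _ G).
    by apply/cvg_ex; exists (l A B); exact: Ll.
  by apply: nearW => n; exact: (bicontent_ge0 (bL n)).
- move=> A A' B mA mA' mB AA'; apply: ll => //; first exact: measurableU.
  under eq_fun do rewrite (bicontentUl (bL _))//.
  by apply: cvgD; exact: Ll.
- move=> A B B' mA mB mB' BB'; apply: ll => //; first exact: measurableU.
  under eq_fun do rewrite (bicontentUr (bL _))//.
  by apply: cvgD; exact: Ll.
- move=> A mA; apply: ll => //.
  by under eq_fun do rewrite (bicontentTr (bL _))//; exact: cvg_cst.
- move=> B mB; apply: ll => //.
  by under eq_fun do rewrite (bicontentTl (bL _))//; exact: cvg_cst.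
Qed.

End bicontent.

(** * Densities bounded by a given function *)

Section density.
Context d (T : measurableType d) (R : realType) (nu : {finite_measure set T -> \bar R}).

(** A Radon-Nikodym density of a measure below [w] times [nu] may be chosen below
    [w] everywhere, and not only almost everywhere, by taking its minimum [g]
    with [w]: the integral of [g] over [B] is at least [k B] because this holds
    on the part of [B] where [g] is the density, by equality, and on the part
    where it is [w], by hypothesis. *)
Lemma density_le (k : {finite_measure set T -> \bar R}) (w : T -> R) :
  measurable_fun setT w -> (forall y, 0 <= w y) ->
  (forall B, measurable B -> (k B <= \int[nu]_(y in B) (w y)%:E)%E) ->
  exists g : T -> R, [/\ measurable_fun setT g, forall y, 0 <= g y <= w y &
    forall B, measurable B -> (\int[nu]_(y in B) (g y)%:E)%E = k B].
Proof.
move=> mw w0 kw.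
have knu : k `<< nu.
  apply/null_content_dominatesP => A mA nuA0; apply/eqP.
  rewrite eq_le measure_ge0 andbT (le_trans (kw _ mA))//.
  have -> : (\int[nu]_(y in A) (w y)%:E = 0)%E; last by [].
  apply: null_set_integral => //.
  by apply/measurable_EFinP; exact: measurable_funTS.
pose f := Radon_Nikodym_SigmaFinite.f k nu.
have f0 y : (0 <= f y)%E by exact: (Radon_Nikodym_SigmaFinite.f_ge0 knu).
have ffin y : f y \is a fin_num by exact: (Radon_Nikodym_SigmaFinite.f_fin_num knu).
have fint B : measurable B -> k B = (\int[nu]_(y in B) f y)%E.
  exact: Radon_Nikodym_SigmaFinite.f_integral.
have mf : measurable_fun setT f.
  by apply: measurable_int; exact: (Radon_Nikodym_SigmaFinite.f_integrable knu).
pose f' y := fine (f y).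
have f'E y : (f' y)%:E = f y by rewrite fineK.
have mf' : measurable_fun setT f'.
  exact: (measurableT_comp (@fine_measurable R setT measurableT) mf).
have f'0 y : 0 <= f' y by rewrite fine_ge0.
have mg : measurable_fun setT (f' \min w) by exact: measurable_minr.
exists (f' \min w); split => //.
  by move=> y /=; rewrite le_min f'0 w0 ge_min lexx orbT.
move=> B mB; apply/eqP; rewrite eq_le; apply/andP; split.
  rewrite (fint _ mB); apply: ge0_le_integral => //.
  - by move=> y _; rewrite lee_fin/= le_min f'0 w0.
  - by apply/measurable_EFinP; exact: measurable_funTS.
  - exact: measurable_funTS.
  - by move=> y _; rewrite -f'E lee_fin/= ge_min lexx.
pose D := [set y | f' y <= w y].
have mD : measurable D by rewrite -[D]setTI; exact: measurable_fun_le.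
have mBD : measurable (B `&` D) by exact: measurableI.
have mBD' : measurable (B `\` D) by exact: measurableD.
rewrite -{1 2}(setUIDK B D).
rewrite measureU//; last by rewrite setIDA setIAC -setIDA setDv setI0 ?setI0.
rewrite ge0_integral_setU//=; first last.
- by rewrite disj_set2E; apply/eqP; rewrite setIDA setIAC -setIDA setDv setI0.
- by move=> y _; rewrite lee_fin le_min f'0 w0.
- by apply/measurable_EFinP; exact: measurable_funTS.
apply: leeD.
  rewrite fint// le_eqVlt; apply/orP; left; apply/eqP/eq_integral => y.
  by rewrite inE => -[_ Dy]; rewrite /= min_l// f'E.
rewrite (le_trans (kw _ mBD'))// le_eqVlt; apply/orP; left; apply/eqP/eq_integral => y.
rewrite inE => -[_ /negP]; rewrite -ltNge => /ltW wf.
by rewrite /= min_r.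
Qed.

End density.

(** * The space of bit sequences *)

(** Prefixes are listed with the latest bit first, so that the children of the
    node [s] of the binary tree are [false :: s] and [true :: s]. *)
Fixpoint bit_prefix (z : nat -> bool) n : seq bool :=
  if n is n'.+1 then z n' :: bit_prefix z n' else [::].

Definition cyl (s : seq bool) : set (nat -> bool) :=
  [set z | bit_prefix z (size s) = s].

(** The empty set is included for stability under intersection. *)
Definition cylinders : set (set (nat -> bool)) :=
  [set C | C = set0 \/ exists s, C = cyl s].

Definition bits : measurableType cylinders.-sigma := g_sigma_algebraType cylinders.

Lemma size_bit_prefix z n : size (bit_prefix z n) = n.
Proof. by elim: n => //= n ->. Qed.

Lemma cylI s t : (size s <= size t)%N ->
  cyl s `&` cyl t = set0 \/ cyl s `&` cyl t = cyl t.
Proof.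
move=> st.
have [[z [zs zt]]|] := pselect ((cyl s `&` cyl t) !=set0); last first.
  by move=> /set0P/negP/negPn/eqP; left.
right; apply: setIidr => z' z't; rewrite /cyl/= in zs zt z't *.
rewrite -zs size_bit_prefix.
have : bit_prefix z' (size t) = bit_prefix z (size t) by rewrite zt.
move: (size s) (size t) st => m n; elim: n => [|n IH]; first by rewrite leqn0 => /eqP ->.
rewrite leq_eqVlt => /orP[/eqP -> //|mn] /= [_]; exact: IH.
Qed.

Lemma cylinders_setI : setI_closed cylinders.
Proof.
move=> _ _ [->|[s ->]] [->|[t ->]]; try by left; rewrite ?set0I ?setI0.
have [st|/ltnW ts] := leqP (size s) (size t).
  by have [->|->] := cylI st; [left|right; exists t].
by rewrite setIC; have [->|->] := cylI ts; [left|right; exists s].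
Qed.

Lemma cyl_nil : cyl [::] = setT. Proof. by apply/seteqP. Qed.

Lemma cyl_cons b s : cyl (b :: s) = cyl s `&` [set z | z (size s) = b].
Proof.
by apply/seteqP; split => z; rewrite /cyl /= => -[zb zs]; [split|rewrite zb zs].
Qed.

Lemma measurable_cyl s : measurable (cyl s : set bits).
Proof. by apply: sub_sigma_algebra; right; exists s. Qed.

Lemma measurable_bit k : measurable [set z : bits | z k].
Proof.
have -> : [set z : bits | z k] =
    \bigcup_(s in [set s : seq bool | size s = k]) cyl (true :: s).
  apply/seteqP; split => [z /= zk|z [s /= <-]]; last by rewrite cyl_cons => -[].
  exists (bit_prefix z k); first exact: size_bit_prefix.
  by rewrite cyl_cons; split; rewrite /cyl/= size_bit_prefix.
rewrite bigcup_mkcond; apply: countable_bigcupT_measurable => // s.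
by case: ifP => // _; exact: measurable_cyl.
Qed.

Lemma measurable_bits d (T : measurableType d) (f : T -> bits) :
  (forall s, measurable (f @^-1` cyl s)) -> measurable_fun setT f.
Proof.
move=> mf; apply: (@measurability _ _ _ bits setT f cylinders) => //.
move=> _ [_ [->|[s ->]] <-]; rewrite setTI.
  by rewrite preimage_set0.
exact: mf.
Qed.

Lemma bits_measure_unique (R : realType) (m1 m2 : {measure set bits -> \bar R}) :
  (m1 setT < +oo)%E -> (forall s, m1 (cyl s) = m2 (cyl s)) ->
  forall C, measurable C -> m1 C = m2 C.
Proof.
move=> m1fin m12 C mC.
apply: (@g_sigma_algebra_measure_unique _ R bits cylinders _
  (fun=> cyl [::]) _ _ m1 m2 _ _ _ C mC).
- by move=> D CD; exact: sub_sigma_algebra.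
- by move=> _; right; exists [::].
- by rewrite cyl_nil bigcup_const//; exists 0%N.
- exact: cylinders_setI.
- by move=> _ [->|[s ->]]; [rewrite (measure0 m1) (measure0 m2)|exact: m12].
- by move=> _; rewrite cyl_nil.
Qed.

Section coding.
Context (T : Type) (E : nat -> set T).
Definition bitcode (x : T) : bits := fun n => `[< E n x >].
Definition cell s : set T := bitcode @^-1` cyl s.

Lemma cell_nil : cell [::] = setT. Proof. by rewrite /cell cyl_nil. Qed.

Lemma cell_split s : cell s = cell (false :: s) `|` cell (true :: s).
Proof.
rewrite /cell !cyl_cons; apply/seteqP; split => [x /= xs|x [|] []//].
by case: (boolP (bitcode x (size s))) => b; [right|left]; split => //; apply/negbTE.
Qed.

Lemma cellI s : cell (false :: s) `&` cell (true :: s) = set0.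
Proof. by rewrite /cell !cyl_cons -subset0 => x [[_ /= ->] []]. Qed.

End coding.

Section measurable_coding.
Context d (T : measurableType d) (E : nat -> set T).
Hypothesis mE : forall n, measurable (E n).

Lemma measurable_cell s : measurable (cell E s).
Proof.
elim: s => [|b s IH]; first by rewrite cell_nil.
rewrite /cell cyl_cons preimage_setI; apply: measurableI => //.
have -> : bitcode E @^-1` [set z | z (size s) = b] =
    if b then E (size s) else ~` E (size s).
  apply/seteqP; split => x/=; rewrite /bitcode; case: asboolP => //; by case: b.
by case: b => //; exact: measurableC.
Qed.

Lemma measurable_bitcode : measurable_fun setT (bitcode E).
Proof. by apply: measurable_bits; exact: measurable_cell. Qed.

End measurable_coding.

(** * Sampling a bit sequence with prescribed conditional probabilities *)

Section density_tree.
Context {R : realType} {d1 d2} {T1 : measurableType d1} {T2 : measurableType d2}.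
Context (mu : probability T1 R) (nu : probability T2 R).
Context (l : set T1 -> set T2 -> R) (bl : bicontent mu nu l).
Context (E : nat -> set T1) (mE : forall n, measurable (E n)).

Definition is_density (A : set T1) (g : T2 -> R) :=
  measurable_fun setT g /\
  forall B, measurable B -> (\int[nu]_(y in B) (g y)%:E)%E = (l A B)%:E.

(** Only the density of the left child is chosen; that of the right child is
    the difference. The densities are thus additive along the tree for every
    [y], with no exceptional null set. *)
Definition lower_density s (w : T2 -> R) : T2 -> R := xget w
  [set g | (forall y, 0 <= g y <= w y) /\ is_density (cell E (false :: s)) g].

Fixpoint density s : T2 -> R := if s is b :: s' then
  let g := lower_density s' (density s') in
  if b then density s' \- g else g else cst 1.

Lemma lower_densityP s w : (forall y, 0 <= w y) -> is_density (cell E s) w ->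
  (forall y, 0 <= lower_density s w y <= w y) /\
  is_density (cell E (false :: s)) (lower_density s w).
Proof.
move=> w0 [mw ws]; apply: (@xgetPex _ w [set g | (forall y, 0 <= g y <= w y) /\
  is_density (cell E (false :: s)) g]).
have [k kE] := bicontent_measurer bl (measurable_cell mE (false :: s)).
have [|g [mg g0 gk]] := @density_le _ _ _ nu k w mw w0.
  move=> B mB; rewrite ws// kE// lee_fin (cell_split E s).
  rewrite (bicontentUl bl)//; [|exact: measurable_cell..|exact: cellI].
  by rewrite lerDl (bicontent_ge0 bl)//; exact: measurable_cell.
exists g; split => //; split => // B mB; by rewrite gk// kE.
Qed.

Lemma densityP s : (forall y, 0 <= density s y) /\ is_density (cell E s) (density s).
Proof.
elim: s => [|b s [w0 ws]] /=.
  split => //; split => // B mB.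
  rewrite cell_nil (bicontentTl bl)// fineK ?fin_num_measure//.
  by rewrite /= integral_cst// mul1e.
have [gw [mg gs]] := lower_densityP w0 ws.
case: b; last by split; [move=> y; case/andP: (gw y)|].
split; first by move=> y; rewrite subr_ge0; case/andP: (gw y).
have [mw wsB] := ws.
split=> [|B mB]; first exact: measurable_funB.
have mgB : measurable_fun B (lower_density s (density s)) by exact: measurable_funTS.
have mwB : measurable_fun B (density s) by exact: measurable_funTS.
have iw : nu.-integrable B (EFin \o density s).
  apply/integrableP; split; first exact/measurable_EFinP.
  under eq_integral do rewrite /= ger0_norm//.
  by rewrite wsB// ltry.
have ig : nu.-integrable B (EFin \o lower_density s (density s)).
  apply/integrableP; split; first exact/measurable_EFinP.
  under eq_integral do rewrite /= ger0_norm ?(andP (gw _)).1//.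
  by rewrite gs// ltry.
rewrite (eq_integral (fun y =>
    (density s y)%:E - (lower_density s (density s) y)%:E)%E); last first.
  by move=> y _; rewrite /= EFinB.
rewrite integralB_EFin// wsB// gs// -EFinB; congr (_%:E).
rewrite (cell_split E s) (bicontentUl bl)//; [|exact: measurable_cell..|exact: cellI].
by rewrite addrC addKr.
Qed.

Lemma density_true s y : density (true :: s) y = density s y - density (false :: s) y.
Proof. by []. Qed.

Lemma density_false s y : 0 <= density (false :: s) y <= density s y.
Proof. by have [w0 ws] := densityP s; have [+ _] := lower_densityP w0 ws; apply. Qed.

Lemma measurable_density s : measurable_fun setT (density s).
Proof. by have [_ []] := densityP s. Qed.

(** For each [y], the node [s] of the tree receives the interval of length
    [density s y] starting at [left_end s y], and the intervals of its children
    divide it. *)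
Fixpoint left_end s y : R := if s is b :: s' then
  left_end s' y + (if b then density (false :: s') y else 0) else 0.

Lemma measurable_left_end s : measurable_fun setT (left_end s).
Proof.
elim: s => [|b s IH]; first exact: measurable_cst.
apply: measurable_funD => //; case: b; last exact: measurable_cst.
exact: measurable_density.
Qed.

Lemma left_end_bounds s y : 0 <= left_end s y /\ left_end s y + density s y <= 1.
Proof.
elim: s => [|b s [l0 l1]]; first by rewrite /= add0r.
have /andP[d0 d1'] := density_false s y.
case: b; split.
- by rewrite /= addr_ge0.
- by rewrite density_true [left_end _ _]/= -addrA [X in _ + X <= _]addrC subrK.
- by rewrite /= addr0.
- by rewrite [left_end _ _]/= addr0 (le_trans _ l1)// lerD2l.
Qed.

(** The path followed by the point [u] of the unit interval in the nested
    intervals attached to [y]. *)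
Fixpoint address y u n : seq bool := if n is n'.+1 then
  let s := address y u n' in (left_end s y + density (false :: s) y <= u) :: s else [::].

Definition locate (yu : T2 * R) : bits := fun n =>
  let s := address yu.1 yu.2 n in left_end s yu.1 + density (false :: s) yu.1 <= yu.2.

Lemma bit_prefix_locate y u n : bit_prefix (locate (y, u)) n = address y u n.
Proof. by elim: n => //= n ->. Qed.

Lemma locate_cyl s y u : 0 <= u < 1 ->
  cyl s (locate (y, u)) <-> left_end s y <= u < left_end s y + density s y.
Proof.
move=> u01; rewrite /cyl/= bit_prefix_locate.
elim: s => [|b s IH]; first by rewrite /= add0r u01; split.
have /andP[d0 d1'] := density_false s y.
split.
- rewrite [address _ _ _]/= => -[bE sE].
  rewrite sE in bE; move/IH: sE => /andP[su us].
  case: b bE => [h|/negbT]; last by rewrite -ltNge => h; rewrite /= addr0 su.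
  by rewrite [left_end _ _]/= h density_true -addrA [X in _ < _ + X]addrC subrK.
- case: b => /=.
    rewrite -addrA [X in _ < _ + X]addrC subrK => /andP[h us].
    have -> : address y u (size s) = s.
      by apply/IH; rewrite us andbT (le_trans _ h)// lerDl.
    by rewrite h.
  rewrite addr0 => /andP[su h].
  have -> : address y u (size s) = s.
    by apply/IH; rewrite su (lt_le_trans h)// lerD2l.
  by congr (_ :: _); apply/negbTE; rewrite -ltNge.
Qed.

Lemma measurable_locate : measurable_fun setT locate.
Proof.
apply: measurable_bits; elim => [|b s IH]; first by rewrite cyl_nil preimage_setT.
rewrite cyl_cons preimage_setI.
have -> : locate @^-1` cyl s `&` locate @^-1` [set z | z (size s) = b] =
    locate @^-1` cyl s `&`
    [set yu | (left_end s yu.1 + density (false :: s) yu.1 <= yu.2) = b].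
  apply/seteqP; split => -[y u] [/= zs zb]; split => //.
  - by rewrite -zb /locate -bit_prefix_locate/= zs.
  - by rewrite /locate -bit_prefix_locate /= zs.
apply: measurableI => //.
rewrite -[X in measurable X]setTI.
have : measurable_fun [set: T2 * R]
    (fun yu => left_end s yu.1 + density (false :: s) yu.1 <= yu.2).
  apply: measurable_fun_ler; last exact: measurable_snd.
  apply: measurable_funD; (apply: measurableT_comp; last exact: measurable_fst).
    exact: measurable_left_end.
  exact: measurable_density.
by move=> /(_ measurableT [set b]); apply.
Qed.

End density_tree.

(** * Kernels into the space of bit sequences *)

Lemma pushforward_probability d d' (T : measurableType d) (T' : measurableType d')
    (R : realType) (P : probability T R) (f : T -> T') : measurable_fun setT f ->
  exists Q : probability T' R, forall A, Q A = P (f @^-1` A).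
Proof.
move=> mf; pose F : {mfun T >-> T'} := HB.pack f (isMeasurableFun.Build _ _ _ _ f mf).
by exists (distribution P F).
Qed.

Lemma lebesgue_unit_interval (R : realType) : exists P : probability R R,
  forall A : set R, P A = lebesgue_measure (A `&` `[0, 1[).
Proof.
pose m := mrestr (@lebesgue_measure R) (measurable_itv `[0, 1[).
have m1 : m setT = 1%E.
  by rewrite /m /mrestr setTI lebesgue_measure_itv/= lte01 oppr0 adde0.
pose P : probability (measurableTypeR R) R :=
  HB.pack m (Measure.on m) (Measure_isProbability.Build _ _ _ m m1).
have mid : measurable_fun setT (idfun : measurableTypeR R -> R).
  by move=> _ A mA; rewrite setTI.
by have [Q QE] := pushforward_probability P mid; exists Q => A; rewrite QE.
Qed.

Lemma pushforward_measure d d' (T : measurableType d) (T' : measurableType d')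
    (R : realType) (m : {measure set T -> \bar R}) (f : T -> T') :
    measurable_fun setT f ->
  exists Q : {measure set T' -> \bar R}, forall A, Q A = m (f @^-1` A).
Proof.
move=> mf.
by exists (measure_function_pushforward__canonical__measure_function_Measure m mf).
Qed.

Section bits_kernel.
Context {R : realType} {d1 d2} {T1 : measurableType d1} {T2 : measurableType d2}.
Context (mu : probability T1 R) (nu : probability T2 R).
Context (l : set T1 -> set T2 -> R) (bl : bicontent mu nu l).

(** The law of [locate (y, u)] for [u] uniform in the unit interval gives to each
    cylinder [cyl s] the mass [density s y]. Integrated over [B], this is the
    image of [l ^~ B] under [bitcode E] on cylinders, hence everywhere. *)
Lemma bits_kernel (E : nat -> set T1) : (forall n, measurable (E n)) ->
  exists K : T2 -> probability bits R,
    (forall C, measurable C -> measurable_fun setT (fun y => K y C)) /\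
    forall C B, measurable C -> measurable B ->
      (\int[nu]_(y in B) K y C)%E = (l (bitcode E @^-1` C) B)%:E.
Proof.
move=> mE.
have [P PE] := lebesgue_unit_interval R.
pose z := locate nu l E : T2 * R -> bits.
have mz : measurable_fun setT z by exact: (measurable_locate bl).
have mzy y : measurable_fun setT (fun u => z (y, u)) by exact: measurable_fun_pair2.
have [|K KE] := @choice _ _ (fun y (Q : probability bits R) =>
    forall C, Q C = P ((fun u => z (y, u)) @^-1` C)).
  by move=> y; exact: pushforward_probability.
have KxE C y : K y C = (P \o xsection (z @^-1` C)) y.
  by rewrite KE /=; congr (P _); rewrite xsectionE.
have mK C : measurable C -> measurable_fun setT (fun y => K y C).
  move=> mC; under eq_fun do rewrite KxE; apply: measurable_fun_xsection.
  by rewrite -[X in measurable X]setTI; exact: mz.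
exists K; split => // C B mC mB.
have mBT : measurable (B `*` [set: R]) by exact: measurableX.
have [m1 m1E] := pushforward_measure (mrestr (nu \x P)%E mBT) mz.
have {}m1E D : m1 D = (\int[nu]_(y in B) K y D)%E.
  rewrite m1E /mrestr/= /product_measure1/= [RHS]integral_mkcond.
  apply: eq_integral => y _; rewrite patchE xsectionI.
  have [yB|yB] := boolP (y \in B).
    by rewrite in_xsectionX// setIT KxE.
  by rewrite notin_xsectionX// setI0 measure0.
have [M2 M2E] := bicontent_measurel bl mB.
have [m2 m2E] := pushforward_measure M2 (measurable_bitcode mE).
have {}m2E D : measurable D -> m2 D = (l (bitcode E @^-1` D) B)%:E.
  move=> mD; rewrite m2E; apply: M2E; rewrite -[X in measurable X]setTI.
  exact: measurable_bitcode.
rewrite -m1E// -m2E//; apply: bits_measure_unique => // [|s].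
  rewrite m1E (@le_lt_trans _ _ (\int[nu]_(y in B) 1)%E)//.
    apply: ge0_le_integral => //; first by apply: measurable_funTS; exact: mK.
    by move=> y _; exact: probability_le1.
  by rewrite integral_cst// mul1e ltey_eq fin_num_measure.
rewrite m1E ?m2E; [|exact: measurable_cyl..].
have [_ <-//] := (densityP bl mE s).2.
apply: eq_integral => y _; rewrite KE PE.
have /andP[d0 d1'] := density_false bl mE s y.
have [l0 l1] := left_end_bounds bl mE s y.
rewrite (_ : _ `&` _ = `[left_end nu l E s y,
    left_end nu l E s y + density nu l E s y[%classic).
  rewrite lebesgue_measure_itv/= lte_fin ltrDl; case: ltP => [_|d0'].
    by rewrite -EFinB addrAC subrr add0r.
  congr (_%:E); apply/eqP; rewrite eq_le d0' andbT; exact: le_trans d0 d1'.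
apply/seteqP; split => u /=.
  by rewrite !in_itv/= => -[uz u01]; apply/(locate_cyl bl mE).
rewrite !in_itv/= => su.
have u01 : 0 <= u < 1.
  by case/andP: su => su us; rewrite (le_trans l0 su) (lt_le_trans us).
by split => //; apply/(locate_cyl bl mE).
Qed.

End bits_kernel.

(** * Polish spaces as retracts of the space of bit sequences *)

Section polish_dist.
Context {R : realType} {X : ptopologicalType}.

(** A complete metric compatible with the topology of [X], with a dense sequence
    [e]; it lives on [X] itself rather than on a homeomorphic metric space. *)
Record polish_metric (dist : X -> X -> R) (e : nat -> X) : Prop := PolishMetric {
  pmetric_eq0 : forall x y, dist x y = 0 -> x = y ;
  pmetric_sym : forall x y, dist x y = dist y x ;
  pmetric_triangle : forall x y z, dist x z <= dist x y + dist y z ;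
  pmetric_ge0 : forall x y, 0 <= dist x y ;
  pmetric_open : forall x r, open [set y | dist x y < r] ;
  pmetric_nbhs : forall A x, open A -> A x -> exists2 r, 0 < r &
    forall y, dist x y < r -> A y ;
  pmetric_dense : forall x r, 0 < r -> exists i, dist x (e i) < r ;
  pmetric_complete : forall u : nat -> X,
    (forall r, 0 < r -> exists N, forall n m,
       (N <= n)%N -> (N <= m)%N -> dist (u n) (u m) < r) ->
    exists x, forall r, 0 < r -> exists N, forall n,
      (N <= n)%N -> dist x (u n) < r }.

Lemma polish_spaceP : polish_space R X ->
  exists dist e, polish_metric dist e.
Proof.
move=> [[D cD dD] [M [f [g [fg gf cf cg cM]]]]].
pose dist x y := mdist (f x) (f y).
have [x0 Dx0] : D !=set0.
  by have [x [_ Dx]] := dD setT (ex_intro _ point I) openT; exists x.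
have [e De] : exists e : nat -> X, forall x, D x -> exists i, e i = x.
  move/countable_injP : cD => [h hinj].
  exists (fun i => xget x0 [set x | D x /\ h x = i]) => x Dx; exists (h x).
  case: xgetP => [y _ [Dy hy]|/(_ x)]; last by case.
  by apply: hinj; rewrite ?inE.
have bdist x r : [set y | dist x y < r] = f @^-1` ball (f x) r.
  by rewrite ballEmdist.
have openb x r : open [set y | dist x y < r].
  rewrite bdist; apply: open_comp; first by move=> *; exact: cf.
  rewrite ballEmdist openE => y /= xy; apply/nbhs_ballP => /=.
  exists (r - mdist (f x) y); first by rewrite /= subr_gt0.
  move=> z; rewrite ballEmdist/= => yz.
  by rewrite (le_lt_trans (metric_triangle _ y _))// -ltrBrDl.
exists dist, e; split.
- by move=> x y /mdist_positivity/(congr1 g); rewrite !fg.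
- by move=> x y; exact: metric_sym.
- by move=> x y z; exact: metric_triangle.
- by move=> x y; exact: mdist_ge0.
- exact: openb.
- move=> A x oA Ax.
  have : nbhs (f x) (g @^-1` A).
    by apply: cg; rewrite fg; exact: open_nbhs_nbhs.
  move/nbhs_ballP => [r /= r0 rA]; exists r => // y xy.
  by have := rA (f y); rewrite ballEmdist/= fg; apply.
- move=> x r r0.
  have [|y [xy /De[i iy]]] := dD [set y | dist x y < r] _ (openb x r).
    by exists x; rewrite /= /dist mdistxx.
  by exists i; rewrite iy.
- move=> u cu.
  have [l ul] : exists l : M, f \o u @ \oo --> l.
    apply: cM; apply/cauchy_ballP => r r0.
    have [N NP] := cu _ r0.
    pose A := [set f (u n) | n in [set n | (N <= n)%N]].
    have FA : (f \o u @ \oo) A by exists N => // n Nn; exists n.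
    exists (A, A) => // -[_ _] /= [[n Nn <-] [m Nm <-]].
    by rewrite ballEmdist/=; exact: NP.
  exists (g l) => r r0; have := ul (ball l r) (nbhsx_ballx _ _ r0).
  move=> [N _ NP]; exists N => n Nn; have := NP n Nn.
  by rewrite ballEmdist/= /dist gf.
Qed.

End polish_dist.

Lemma exp2V_lt (R : realType) (r : R) : 0 < r ->
  exists N, forall n, (N <= n)%N -> 2^-1 ^+ n < r.
Proof.
move=> r0; have := @cvg_expr R 2^-1 _.
rewrite ger0_norm// invf_lt1// ltr1n => /(_ isT) /cvgrPdist_lt /(_ _ r0) [N _ NP].
by exists N => n /NP; rewrite /= sub0r normrN ger0_norm// exprn_ge0.
Qed.

Section base_code.
Context {R : realType} {X : ptopologicalType}.
Context (dist : X -> X -> R) (e : nat -> X) (de : polish_metric dist e).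

Definition basic_ball (n i : nat) : set X := [set y | dist y (e i) < 2^-1 ^+ n].

Definition basic_open (k : nat) : set X :=
  if unpickle k is Some (n, i) then basic_ball n i else set0.

Lemma basic_openE n i : basic_open (pickle (n, i)) = basic_ball n i.
Proof. by rewrite /basic_open pickleK. Qed.

Lemma open_basic_ball n i : open (basic_ball n i).
Proof.
rewrite (_ : basic_ball n i = [set y | dist (e i) y < 2^-1 ^+ n]).
  exact: (pmetric_open de).
by apply/seteqP; split => y; rewrite /basic_ball/= (pmetric_sym de).
Qed.

Lemma open_basic_open k : open (basic_open k).
Proof.
rewrite /basic_open; case: unpickle => [[n i]|]; last exact: open0.
exact: open_basic_ball.
Qed.

Lemma exp2V_gt0 n : 0 < (2^-1 : R) ^+ n.
Proof. by rewrite exprn_gt0// invr_gt0. Qed.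

Lemma basic_ball_dense x n : exists i, basic_ball n i x.
Proof. exact: (pmetric_dense de x (exp2V_gt0 n)). Qed.

Lemma closed_ball_base A x : open A -> A x ->
  exists n, forall i, dist x (e i) <= 2^-1 ^+ n ->
    [set y | dist y (e i) <= 2^-1 ^+ n] `<=` A.
Proof.
move=> oA /(pmetric_nbhs de oA)[r r0 rA].
have [n /(_ _ (leqnn n)) nr] := exp2V_lt (divr_gt0 r0 (ltr0Sn R 1)).
exists n => i xi y /= yi; apply: rA; rewrite (splitr r).
rewrite (le_lt_trans (pmetric_triangle de _ (e i) _))//.
by apply: ltrD; [exact: le_lt_trans nr|rewrite (pmetric_sym de); exact: le_lt_trans nr].
Qed.

Lemma basic_open_base A x : open A -> A x ->
  exists2 k, basic_open k x & basic_open k `<=` A.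
Proof.
move=> oA Ax; have [n nA] := closed_ball_base oA Ax.
have [i xi] := basic_ball_dense x n.
exists (pickle (n, i)); rewrite basic_openE// => y /ltW yi.
by apply: nA yi; exact: ltW.
Qed.

Let bit (n i : nat) : set bits := [set z | z (pickle (n, i))].

Let mbit n i : measurable (bit n i). Proof. exact: measurable_bit. Qed.

(** Closed balls are used so that the limit of the centers is named. *)
Definition names (z : bits) (x : X) :=
  forall n i : nat, z (pickle (n, i)) -> dist x (e i) <= 2^-1 ^+ n.

(** The sequences of bits that do name a point: balls of all radii are
    selected, and any two selected balls have close centers. Only countably
    many conditions on bits are imposed, whence measurability. *)
Definition coherent : set bits :=
  (\bigcap_n \bigcup_i bit n i) `&`
  \bigcap_(c : (nat * nat) * (nat * nat))
    (if dist (e c.1.2) (e c.2.2) <= 2^-1 ^+ c.1.1 + 2^-1 ^+ c.2.1 then setT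
     else ~` (bit c.1.1 c.1.2 `&` bit c.2.1 c.2.2)).

Lemma measurable_coherent : measurable coherent.
Proof.
apply: measurableI.
  by apply: bigcapT_measurable => n; exact: bigcupT_measurable.
rewrite -[X in measurable X]setCK setC_bigcap; apply: measurableC.
apply: countable_bigcupT_measurable => // -[[n i] [m j]] /=.
apply: measurableC; case: ifP => // _.
by apply: measurableC; exact: measurableI.
Qed.

Lemma coherent_dist z n i m j : coherent z -> z (pickle (n, i)) -> z (pickle (m, j)) ->
  dist (e i) (e j) <= 2^-1 ^+ n + 2^-1 ^+ m.
Proof.
move=> [_ /(_ ((n, i), (m, j)) I)] /=; case: ifP => // _ nz zn zm.
by exfalso; apply: nz; split.
Qed.

(** The centers of selected balls of radii [2^-1 ^+ n] form a Cauchy sequence. *)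
Lemma coherent_names z : coherent z -> exists x, names z x.
Proof.
move=> zc; have [zn _] := zc.
have [|c cz] := @choice _ _ (fun n i : nat => z (pickle (n, i))).
  by move=> n; have [i _ zi] := zn n I; exists i.
have [r r0|x xc] := pmetric_complete de (u := fun n => e (c n)).
  have [N Nr] := exp2V_lt (divr_gt0 r0 (ltr0Sn R 1)).
  exists N => n m Nn Nm; rewrite (splitr r).
  rewrite (le_lt_trans (coherent_dist zc (cz n) (cz m)))//.
  by apply: ltrD; exact: Nr.
exists x => n i zni; apply/ler_addgt0Pl => r r0.
have r20 : 0 < r / 2 by rewrite divr_gt0.
have [N NP] := xc (r / 2) r20; have [N' N'P] := exp2V_lt r20.
pose m := maxn N N'.
rewrite (le_trans (pmetric_triangle de _ (e (c m)) _))// (splitr r) -addrA.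
apply: lerD; first by rewrite ltW// NP// leq_maxl.
rewrite (le_trans (coherent_dist zc (cz m) zni))// lerD2r.
by rewrite ltW// N'P// leq_maxr.
Qed.

Lemma names_eq z x x' : coherent z -> names z x -> names z x' -> x = x'.
Proof.
move=> [zn _] zx zx'; apply: (pmetric_eq0 de); apply/eqP.
rewrite eq_le (pmetric_ge0 de) andbT; apply/ler_addgt0Pl => r r0; rewrite addr0.
have [N NP] := @exp2V_lt R (r / 2) (divr_gt0 r0 (ltr0Sn R 1)).
have [i _ zi] := zn N I; rewrite (splitr r).
rewrite (le_trans (pmetric_triangle de _ (e i) _))//.
have NN := NP N (leqnn N).
apply: lerD; first by rewrite (le_trans (zx _ _ zi))// ltW.
by rewrite (pmetric_sym de) (le_trans (zx' _ _ zi))// ltW.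
Qed.

Lemma bitcode_coherent x : coherent (bitcode basic_open x).
Proof.
split=> [n _|[[n i] [m j]] _ /=].
  have [i xi] := basic_ball_dense x n.
  by exists i => //; rewrite /bit/= /bitcode basic_openE; exact/asboolP.
case: ifPn => // /negP; apply: contra_not => -[].
rewrite /bit/= /bitcode !basic_openE => /asboolP/= xi /asboolP/= xj.
rewrite (le_trans (pmetric_triangle de _ x _))// (pmetric_sym de (e i)).
by apply: lerD; exact: ltW.
Qed.

Lemma bitcode_names x : names (bitcode basic_open x) x.
Proof. by move=> n i; rewrite /bitcode basic_openE => /asboolP/ltW. Qed.

Definition decode (z : bits) : borel X := xget point [set x | coherent z /\ names z x].

Lemma decodeK x : decode (bitcode basic_open x) = x.
Proof.
rewrite /decode; case: xgetP => [y _ [zc zy]|/(_ x) []].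
  exact: names_eq zc zy (@bitcode_names x).
by split; [exact: bitcode_coherent|exact: bitcode_names].
Qed.

Lemma decode_names z : coherent z -> names z (decode z).
Proof.
move=> zc; have [x zx] := coherent_names zc.
by rewrite /decode; case: xgetP => [y _ []//|/(_ x) []].
Qed.

(** A named point belongs to the open set [A] exactly when one of the balls that
    name it is included in [A]. *)
Lemma decode_open A : open A -> coherent `&` decode @^-1` A =
  coherent `&` \bigcup_(c in [set c : nat * nat |
    [set y | dist y (e c.2) <= 2^-1 ^+ c.1] `<=` A]) bit c.1 c.2.
Proof.
move=> oA; apply/seteqP; split => z [zc zA]; split => //.
  have [n nA] := closed_ball_base oA zA.
  have [i _ zi] := zc.1 n I.
  exists (n, i) => //=; apply: nA; exact: decode_names zi.
have [[n i] /= niA zi] := zA; apply: niA; exact: decode_names zi.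
Qed.

Lemma measurable_decode : measurable_fun setT decode.
Proof.
apply: (@measurability _ _ _ (borel X) setT decode (@open X)) => // _ [A oA <-].
rewrite setTI -(setUIDK (decode @^-1` A) coherent); apply: measurableU.
  rewrite setIC decode_open//; apply: measurableI; first exact: measurable_coherent.
  rewrite bigcup_mkcond; apply: countable_bigcupT_measurable => // c.
  by case: ifP.
have [pA|pA] := pselect (A point).
  rewrite (_ : _ `\` _ = ~` coherent).
    by apply: measurableC; exact: measurable_coherent.
  apply/seteqP; split => [z []//|z nz]; split => //.
  by rewrite /decode/=; case: xgetP => // y _ [].
rewrite (_ : _ `\` _ = set0)// -subset0 => z [+ nz].
by rewrite /decode/=; case: xgetP => // y _ [].
Qed.

End base_code.

Section standard_kernel.
Context {R : realType} {X : ptopologicalType} {d} {T : measurableType d}.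

(** Disintegration with respect to the second marginal. The balls selected by the
    code of a point determine it, so that the kernel into the space of bits can
    be pushed forward by [decode] without loss. *)
Lemma polish_kernel (mu : probability (borel X) R) (nu : probability T R) l :
  polish_space R X -> bicontent mu nu l ->
  exists K : T -> probability (borel X) R,
    (forall A, measurable A -> measurable_fun setT (fun y => K y A)) /\
    forall A B, measurable A -> measurable B -> (\int[nu]_(y in B) K y A)%E = (l A B)%:E.
Proof.
move=> /polish_spaceP[dist [e de]] bl.
have mE n : measurable (basic_open dist e n : set (borel X)).
  by apply: sub_sigma_algebra; exact: open_basic_open.
have [K0 [mK0 K0E]] := bits_kernel bl mE.
have [|K KE] := @choice _ _ (fun y (Q : probability (borel X) R) =>
    forall A, Q A = K0 y (decode dist e @^-1` A)).
  by move=> y; apply: pushforward_probability; exact: measurable_decode.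
have md A : measurable A -> measurable (decode dist e @^-1` A).
  by move=> mA; rewrite -[X in measurable X]setTI; exact: (measurable_decode de).
exists K; split => [A mA|A B mA mB].
  by under eq_fun do rewrite KE; apply: mK0; exact: md.
under eq_integral do rewrite KE; rewrite K0E//; last exact: md.
congr (l _ B)%:E; apply/funext => x.
by rewrite /preimage/= (decodeK de).
Qed.

End standard_kernel.

(** * Disintegration along a multifunction with closed graph *)

Lemma closed_mf_fiber (X Y : ptopologicalType) (F : X -> set Y) y :
  closed (mf_graph F) -> closed (mf_preimage F [set y]).
Proof.
move=> cF; have -> : mf_preimage F [set y] = (fun x => (x, y)) @^-1` mf_graph F.
  apply/seteqP; split => x; rewrite /mf_preimage /mf_graph/=.
    by move=> [y' [Fxy <-]].
  by move=> Fxy; exists y.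
apply: closed_comp => // x _; apply: cvg_pair => //; exact: cvg_cst.
Qed.

Lemma measurable_mf_fiber (X Y : ptopologicalType) (F : X -> set Y) y :
  closed (mf_graph F) -> measurable (mf_preimage F [set y] : set (borel X)).
Proof.
move=> /(@closed_mf_fiber _ _ _ y)/closed_openC oF; rewrite -[X in measurable X]setCK.
by apply: measurableC; exact: sub_sigma_algebra.
Qed.

(** The complement of the graph is open and the products of basic open sets form
    a countable base; indices that do not encode such a product outside of the
    graph are sent to the empty rectangle. *)
Lemma graph_cover (R : realType) (X Y : ptopologicalType) (F : X -> set Y) :
  polish_space R X -> polish_space R Y -> closed (mf_graph F) ->
  exists (U : nat -> set X) (V : nat -> set Y),
    [/\ forall k, open (U k), forall k, open (V k) &
      forall x y, ~ F x y <-> exists k, U k x /\ V k y].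
Proof.
move=> /polish_spaceP[dX [eX hX]] /polish_spaceP[dY [eY hY]] cF.
pose BX := basic_open dX eX; pose BY := basic_open dY eY.
pose P i j := BX i `*` BY j `<=` ~` mf_graph F.
pose W k := if unpickle k is Some (i, j) then
  if `[< P i j >] then (BX i, BY j) else (set0, set0) else (set0, set0).
exists (fst \o W), (snd \o W); split.
- move=> k; rewrite /W/=; case: unpickle => [[i j]|]; last exact: open0.
  by case: ifP => _; [exact: open_basic_open|exact: open0].
- move=> k; rewrite /W/=; case: unpickle => [[i j]|]; last exact: open0.
  by case: ifP => _; [exact: open_basic_open|exact: open0].
move=> x y; split=> [nF|[k]]; last first.
  rewrite /W/=; case: unpickle => [[i j]|]; last by case.
  case: asboolP => [Pij|_] [] //= xi yj; exact: (Pij (x, y)).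
have : nbhs (x, y) (~` mf_graph F).
  by apply: open_nbhs_nbhs; split => //; exact: closed_openC.
case=> -[A B] /= [Ax By] AB.
move: Ax By; rewrite !nbhsE => -[A' [oA' A'x] A'A] [B' [oB' B'y] B'B].
have [i xi iA] := basic_open_base hX oA' A'x.
have [j yj jB] := basic_open_base hY oB' B'y.
exists (pickle (i, j)); rewrite /W pickleK.
case: asboolP => //= -[]; move=> [x' y'] [/= x'i y'j]; apply: AB; split => /=.
  exact/A'A/iA.
exact/B'B/jB.
Qed.

(** Near [y], all the sets [V i] with [i < n] that contain [y] still contain the
    point, so that the incidence vector can only grow. *)
Lemma open_incidence_upset (Y : topologicalType) (V : nat -> set Y) n
    (S : {set {ffun 'I_n -> bool}}) :
    (forall k, open (V k)) ->
    (forall t t' : {ffun 'I_n -> bool},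
      t \in S -> (forall i, t i -> t' i) -> t' \in S) ->
  open (incidence V n @^-1` [set` S]).
Proof.
move=> oV upS; rewrite openE => y /= yS.
have : \forall y' \near y, forall i : 'I_n, incidence V n y i -> V i y'.
  apply: filter_forall => i; case: (incidenceP V y i) => Vy; last exact: nearW.
  have : nbhs y (V i) by apply: open_nbhs_nbhs.
  by apply: filterS.
apply: filterS => y' h; apply: upS yS _ => i /h Viy'.
exact/incidenceP.
Qed.

Lemma coupling_exists (R : realType) (X Y : ptopologicalType)
    (mu : probability (borel X) R) (nu : probability (borel Y) R)
    (F : X -> set Y) (hF : mf_measurable F)
    (U : nat -> set X) (V : nat -> set Y) :
  (forall k, open (U k)) -> (forall k, open (V k)) ->
  (forall x y k, F x y -> ~ (U k x /\ V k y)) ->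
  (forall O : set Y, open O -> (nu O <= mu (mf_preimage F O))%E) ->
  exists2 l, bicontent mu nu l & forall k, l (U k) (V k) = 0.
Proof.
move=> oU oV UVF hall.
have mU k : measurable (U k : set (borel X)) by exact: sub_sigma_algebra.
have mV k : measurable (V k : set (borel Y)) by exact: sub_sigma_algebra.
have [|L LP] := @choice _ _ (fun n l => bicontent mu nu l /\
    forall k, (k < n)%N -> l (U k) (V k) = 0).
  move=> n.
  have [|l bl l0] := @finite_coupling R _ _ _ _ mu nu n U V mU mV; last by exists l.
  move=> S upS.
  have oO := open_incidence_upset oV upS.
  apply: le_trans (hall _ oO) _; apply: le_measure; rewrite ?inE.
  - by apply: hF; exact: sub_sigma_algebra.
  - pose D : {set {ffun 'I_n -> bool}} :=
      [set s : {ffun 'I_n -> bool} | [exists t in S, [forall i, ~~ (s i && t i)]]]%SET.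
    rewrite (_ : [set x | _] = incidence U n @^-1` [set` D]).
      by apply: measurable_fiber; exact: measurable_incidence.
    apply/seteqP; split => x /=; rewrite inE.
      by move=> [t tS h]; apply/existsP; exists t; rewrite tS; exact/forallP.
    by move=> /existsP[t /andP[tS /forallP h]]; exists t.
  - move=> x [y [Fxy yS]]; exists (incidence V n y) => // i.
    by apply/negP => /andP[/incidenceP Ux /incidenceP Vy]; exact: (UVF x y i Fxy).
have [l bl l0] := bicontent_limit (fun n => (LP n).1).
exists l => // k; apply: l0 => //; exists k.+1 => // n kn.
exact: (LP n).2.
Qed.

(** For almost every [y] in [U], the fiber of [y], which has full measure, is
    included in [mf_preimage F U]. *)
Lemma disintegration_hall (R : realType) (X Y : ptopologicalType)
    (mu : probability (borel X) R) (nu : probability (borel Y) R)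
    (F : X -> set Y) (hF : mf_measurable F) (hG : closed (mf_graph F))
    (mu_ : borel Y -> probability (borel X) R) : disintegration mu nu F mu_ ->
  forall U : set Y, open U -> (nu U <= mu (mf_preimage F U))%E.
Proof.
move=> [mmu aemu muE] U oU.
have mU : measurable (U : set (borel Y)) by exact: sub_sigma_algebra.
have mFU := hF _ mU.
rewrite muE// -[leLHS]mul1e -integral_cst//.
apply: (@le_trans _ _ (\int[nu]_(y in U) mu_ y (mf_preimage F U))%E); last first.
  by apply: ge0_subset_integral => //; exact: mmu.
apply: ae_ge0_le_integral => //; first by apply: measurable_funTS; exact: mmu.
apply: filterS aemu => y <- Uy /=.
apply: le_measure; rewrite ?inE//; first exact: measurable_mf_fiber.
by move=> x [y' [Fxy y'y]]; exists y => //; split => //; rewrite -y'y.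
Qed.

Theorem theorem1p1 (R : realType) (X Y : ptopologicalType)
    (hX : polish_space R X) (hY : polish_space R Y)
    (mu : probability (borel X) R) (nu : probability (borel Y) R)
    (F : X -> set Y) (hF : mf_measurable F) (hG : closed (mf_graph F)) :
  (exists mu_ : borel Y -> probability (borel X) R,
     disintegration mu nu F mu_) <->
  (forall U : set Y, open U -> (nu U <= mu (mf_preimage F U))%E).
Proof.
split=> [[mu_ /disintegration_hall]|hall]; first exact.
have [U [V [oU oV UVF]]] := graph_cover hX hY hG.
have [|l bl l0] := coupling_exists hF oU oV _ hall.
  by move=> x y k Fxy UV; have [_] := UVF x y; apply => //; exists k.
have mU k : measurable (U k : set (borel X)) by exact: sub_sigma_algebra.
have mV k : measurable (V k : set (borel Y)) by exact: sub_sigma_algebra.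
have [K [mK KE]] := polish_kernel hX bl.
exists K; split => //; last first.
  by move=> A mA; rewrite KE// (bicontentTr bl)// fineK// fin_num_measure.
have Kae : {ae nu, forall y, forall k, V k y -> K y (U k) = 0%E}.
  apply: ae_foralln => k.
  have := KE _ _ (mU k) (mV k); rewrite l0 => /=.
  have mKV : measurable_fun (V k : set (borel Y)) (fun y => K y (U k)).
    by apply: measurable_funTS; exact: mK.
  rewrite (eq_integral (fun y => `|K y (U k)|%E)); last by move=> y _; rewrite gee0_abs.
  by move/(ae_eq_integral_abs nu (mV k) mKV).
move: Kae.
apply: (@filterS _ (almost_everywhere nu) (ae_filter_ringOfSetsType nu)) => y K0.
have mFy := measurable_mf_fiber y hG.
have : K y (~` mf_preimage F [set y]) = 0%E.
  (* The sets [U k] with [V k y] cover the complement of the fiber of [y]. *)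
  have -> : ~` mf_preimage F [set y] = \bigcup_k (if `[< V k y >] then U k else set0).
    apply/seteqP; split => x.
      move=> nx; have [|k [Ux Vy]] := (UVF x y).1.
        by move=> Fxy; apply: nx; exists y.
      by exists k => //; case: asboolP.
    move=> [k _]; case: asboolP => // Vy Ux [y' [Fxy y'y]].
    by apply: (UVF x y).2; [exists k|rewrite -y'y].
  apply/eqP; rewrite eq_le measure_ge0 andbT.
  rewrite (le_trans (@generalized_Boole_inequality _ _ _ (K y) _ _ _))//.
  - by move=> k; case: ifP.
  - by apply: bigcupT_measurable => k; case: ifP.
  rewrite eseries0// => k _ _; case: asboolP; last by rewrite measure0.
  exact: K0.
rewrite probability_setC// => /eqP; rewrite sube_eq ?add0e// ?fin_num_measure//.
  by move=> /eqP.
Qed.
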